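(* For every real $r > \tfrac12$ there exist a positive integer $k = k(r)$, a real number $c = c(r) > 1$ and a function $\delta(d)$ with $\delta(d) \to 0$ as $d\to\infty$ such that for all $d$, $$ f_r(d) \ge \bigl(c + \delta(d)\bigr)^{d^{1/(2k)}}. $$
   Context: For $\Omega \subset \mathbb{R}^d$, $\operatorname{diam}\Omega = \sup_{x,y\in\Omega}|x-y|$ (Euclidean distance). $f(\Omega)$ denotes the minimum number $f$ such that $\Omega = \Omega_1\cup\dots\cup\Omega_f$ with $\operatorname{diam}\Omega_i < \operatorname{diam}\Omega$ for all $i$. $S_r^{d-1}\subset\mathbb{R}^d$ is the sphere of radius $r$ centred at the origin, and $f_r(d) = \max\{ f(\Omega) : \Omega \subset S_r^{d-1},\ \operatorname{diam}\Omega = 1\}$. *)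

(* Defs.v *)
From Stdlib Require Import Reals List.
Open Scope R_scope.

(* A point of R^d is represented by a function nat -> R whose coordinates
   of index >= d vanish (see [in_Rd]). *)
Definition point := nat -> R.

Definition in_Rd (d : nat) (x : point) : Prop := forall i, (d <= i)%nat -> x i = 0.

Definition sqnorm (d : nat) (x : point) : R :=
  fold_right Rplus 0 (map (fun i => (x i) ^ 2) (seq 0 d)).

Definition dist (d : nat) (x y : point) : R :=
  sqrt (fold_right Rplus 0 (map (fun i => (x i - y i) ^ 2) (seq 0 d))).

Definition sphere (d : nat) (r : R) (x : point) : Prop :=
  in_Rd d x /\ sqnorm d x = r ^ 2.

Definition diam_is (d : nat) (A : point -> Prop) (D : R) : Prop :=
  is_lub (fun t => exists x y, A x /\ A y /\ t = dist d x y) D.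

(* diam A < D  (sup of pairwise distances is < D; the empty set qualifies) *)
Definition diam_lt (d : nat) (A : point -> Prop) (D : R) : Prop :=
  exists D', D' < D /\ forall x y, A x -> A y -> dist d x y <= D'.

Definition coverable (d : nat) (A : point -> Prop) (D : R) (n : nat) : Prop :=
  exists P : nat -> point -> Prop,
    (forall x, A x <-> exists i, (i < n)%nat /\ P i x) /\
    (forall i, (i < n)%nat -> diam_lt d (P i) D).

Definition borsuk_number (d : nat) (A : point -> Prop) (n : nat) : Prop :=
  exists D, diam_is d A D /\ coverable d A D n /\
    forall m, coverable d A D m -> (n <= m)%nat.

Definition f_r_is (r : R) (d : nat) (n : nat) : Prop :=
  (exists A, (forall x, A x -> sphere d r x) /\ diam_is d A 1 /\ borsuk_number d A n) /\
  (forall A m, (forall x, A x -> sphere d r x) -> diam_is d A 1 ->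
     borsuk_number d A m -> (m <= n)%nat).

(* Main.v *)
(** Let t be the cosine between two normalised +-1 vectors u, v in dimension n.
    The map u |-> (alpha u, beta u^{(x)N}, gamma), N even, turns t into the inner
    product alpha^2 t + beta^2 t^N + gamma^2.  This is convex in t, and
    beta^2 / alpha^2 can be tuned so that its unique minimum, i.e. the maximal
    distance, is at a prescribed t = -s; gamma adjusts the radius.  As N grows
    and s tends to 1, the ratio of radius to diameter approaches 1/2.  A part of
    smaller diameter then comes from vectors which never meet at cosine -s.  For
    vectors with w = n/2 positive signs this forbids one intersection size p of
    w-sets, with w - p = 2^a, so by the Frankl-Wilson argument modulo 2 such a part
    has at most sum_{i < 2^a} C(n, i) elements, exponentially fewer than C(n, w). *)

Require Import Defs.
From Stdlib Require Import Reals List Lra Lia.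
Open Scope R_scope.

(* The module confines MathComp's notations: in the theorem, [<=] and [<] on [nat]
   have to be Stdlib's propositions rather than boolean tests. *)
Module SphericalBorsuk.
From mathcomp Require Import all_boot all_order all_algebra zify ring lra.
From mathcomp Require Import boolp Rstruct.
Set Implicit Arguments. Unset Strict Implicit. Unset Printing Implicit Defensive.
Local Open Scope nat_scope.
Import Order.TTheory GRing.Theory Num.Theory.

(** * Frankl-Wilson bound modulo a power of two *)

(** Lucas's theorem modulo 2 for the lowest binary digit; it reflects (1 + X)^(2m) = (1 + X^2)^m
    over F_2. *)
Lemma odd_bin_double m k :
  odd 'C(m.*2, k.*2) = odd 'C(m, k) /\ odd 'C(m.*2, k.*2.+1) = false.
Proof.
elim: m k => [|m IH] [|k]; rewrite ?bin0 //.
  by split=> //; rewrite bin1 odd_double.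
have [IHa IHb] := IH k; have [IHc IHd] := IH k.+1.
rewrite !doubleS in IHc IHd *; rewrite !binS !oddD.
by rewrite IHa IHb IHc IHd; do 2!case: (odd _).
Qed.

(** All binary digits of 2^a - 1 are ones, so by Lucas the binomial is odd exactly when the a lowest
    digits of x are ones. *)
Lemma odd_bin_pow2 a x : odd 'C(x, (2 ^ a).-1) = (2 ^ a %| x.+1).
Proof.
elim: a x => [|a IH] x; first by rewrite bin0 dvd1n.
have e2 : (2 ^ a.+1).-1 = (2 ^ a).-1.*2.+1.
  by rewrite expnS mul2n -{1}(prednK (expn_gt0 2 a)) doubleS.
have ex : x = odd x + x./2.*2 by rewrite odd_double_half.
rewrite e2 {}ex; case: (odd x); rewrite ?add0n ?add1n.
  rewrite binS oddD !(odd_bin_double _ _).1 (odd_bin_double _ _).2 /=.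
  by rewrite IH expnS -doubleS -!mul2n dvdn_pmul2l.
rewrite (odd_bin_double _ _).2; apply/esym/negbTE/negP => h.
have : 2 %| x./2.*2.+1 by apply: dvdn_trans h; rewrite expnS dvdn_mulr.
by rewrite dvdn2 /= odd_double.
Qed.

Lemma card_lt_sets n q : #|[set T : {set 'I_n} | #|T| < q]| = \sum_(i < q) 'C(n, i).
Proof.
elim: q => [|q IH].
  by rewrite big_ord0; apply/eqP; rewrite cards_eq0; apply/eqP/setP=> T; rewrite !inE.
rewrite big_ord_recr /= -IH.
have <- : #|[set T : {set 'I_n} | #|T| == q]| = 'C(n, q).
  by rewrite card_draws card_ord.
have -> : [set T : {set 'I_n} | #|T| < q.+1] =
    [set T : {set 'I_n} | #|T| < q] :|: [set T : {set 'I_n} | #|T| == q].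
  by apply/setP=> T; rewrite !inE ltnS leq_eqVlt orbC.
rewrite cardsU [X in _ - X]eq_card0 ?subn0 // => T.
by rewrite !inE; case: ltngtP.
Qed.

(** Vandermonde's identity, with the i-subsets of D listed one by one. When D is an intersection,
    the inclusion splits into a product of two inclusions, hence a matrix factorisation. *)
Lemma sum_subsets_bin (T : finType) (D : {set T}) c q :
  \sum_(A : {set T} | #|A| < q.+1) (A \subset D) * 'C(c, q - #|A|) =
  'C(#|D| + c, q).
Proof.
rewrite -binomial.Vandermonde.
rewrite (partition_big (fun A : {set T} => inord #|A| : 'I_q.+1) xpredT) //=.
apply: eq_bigr => i _; rewrite -cards_draws -sum1_card big_distrl /=.
rewrite big_mkcond [RHS]big_mkcond /=; apply: eq_bigr => A _; rewrite inE.
case: ifPn => [/andP[Aq /eqP <-]|].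
  by rewrite inordK // eqxx andbT; case: ifP; rewrite ?mul1n.
rewrite negb_and; case: (ltnP #|A| q.+1) => /= [Aq|Aq _].
  move=> /eqP nAi; case: (#|A| =P i) => [Ai|]; last by rewrite andbF.
  by case: nAi; apply/val_inj; rewrite /= inordK.
by rewrite [#|A| == i]gtn_eqF ?andbF // (leq_trans (ltn_ord i)).
Qed.

(* 'C(|A :&: B| + 2^a - p - 1, 2^a - 1) is odd iff |A :&: B| = p modulo 2^a; by
   Vandermonde the matrix of these numbers factors through the sets of size < 2^a,
   and modulo 2 its restriction to S is the identity. *)
Lemma frankl_wilson n a p (S : {set {set 'I_n}}) :
  0 < p < 2 ^ a -> (forall A, A \in S -> #|A| = 2 ^ a + p) ->
  (forall A B, A \in S -> B \in S -> #|A :&: B| != p) ->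
  #|S| <= \sum_(i < 2 ^ a) 'C(n, i).
Proof.
set q := 2 ^ a => /andP[p0 pq] cS forb.
pose I := [set T : {set 'I_n} | #|T| < q].
have q0 : 0 < q by rewrite expn_gt0.
pose c := q - p.+1.
rewrite -card_lt_sets -/I.
pose U : 'M['F_2]_(#|S|, #|I|) := (\matrix_(i, j)
  ((enum_val j : {set 'I_n}) \subset (enum_val i : {set 'I_n}))%:R)%R.
pose V : 'M['F_2]_(#|I|, #|S|) := (\matrix_(j, i)
  (((enum_val j : {set 'I_n}) \subset (enum_val i : {set 'I_n})) *
   'C(c, q.-1 - #|(enum_val j : {set 'I_n})|))%N%:R)%R.
suff UV : (U *m V = 1%:M)%R.
  have := mxrankM_maxl U V; rewrite UV mxrank1 => /leq_trans; apply.
  exact: rank_leq_col.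
apply/matrixP=> i j; rewrite !mxE.
set A := enum_val i; set B := enum_val j.
have AS : A \in S := enum_valP i; have BS : B \in S := enum_valP j.
transitivity ('C(#|A :&: B| + c, q.-1)%:R : 'F_2)%R.
  rewrite -sum_subsets_bin prednK // natr_sum.
  transitivity (\sum_(T in I) ((T \subset A :&: B) * 'C(c, q.-1 - #|T|))%:R : 'F_2)%R.
    rewrite [RHS]big_enum_val; apply: eq_bigr => k _; rewrite !mxE -natrM mulnA.
    by rewrite mulnb subsetI.
  by apply: eq_bigl => T; rewrite inE.
have -> x : (x%:R = (odd x)%:R :> 'F_2)%R.
  by apply/val_inj; rewrite /= !val_Fp_nat // modn2; case: odd.
rewrite odd_bin_pow2 -/q; congr (nat_of_bool _)%:R%R.
have [eij|nij] := eqVneq i j.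
  by rewrite /A /B eij setIid cS ?enum_valP //; apply/dvdnP; exists 2; rewrite /c; lia.
apply/negbTE/negP => /dvdnP[t sE].
have AB : A != B by apply: contra nij => /eqP/enum_val_inj->.
(* As A and B differ, [#|A :&: B| + c + 1 = #|A :&: B| + q - p] lies strictly between 0 and 2q; a
   multiple of q there is q itself, which forces the forbidden size p. *)
have sq : #|A :&: B| < q + p.
  rewrite -(cS _ AS) ltn_neqAle subset_leq_card ?subsetIl // andbT.
  apply: contra AB => /eqP e.
  have AIB : A :&: B = A by apply/eqP; rewrite eqEcard subsetIl e leqnn.
  by rewrite eqEcard (cS _ AS) (cS _ BS) leqnn -AIB subsetIr.
have /eqP sp := forb _ _ AS BS; apply: sp.
rewrite /c in sE.
case: t sE => [|[|t]] sE; lia.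
Qed.

(* The binomials C(n, j), n = 2 h (x + 1), grow by a factor (x + 2) / x at each step
   up to j = h x, which is h steps short of the middle. *)
Lemma bin_step x h j : j < h * x ->
  x.+2 * 'C(2 * (h * x.+1), j) <= x * 'C(2 * (h * x.+1), j.+1).
Proof.
set n := 2 * _ => jx; rewrite -(leq_pmul2l (ltn0Sn j)).
rewrite [leqRHS]mulnCA mul_bin_left !mulnA leq_mul2r; apply/orP; right.
have : h * x.+2 <= n - j by rewrite /n; lia.
by nia.
Qed.

Lemma bin_le_half w j : j <= w -> 'C(2 * w, j) <= 'C(2 * w, w).
Proof.
move=> jw; rewrite -(subnKC jw); move: {jw}(w - j) (subnKC jw) => i.
elim: i j => [|i IH] j jw; first by rewrite addn0.
rewrite addnS -addSn; apply: leq_trans (IH _ _); last by rewrite addSn -addnS.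
rewrite -(leq_pmul2l (ltn0Sn j)) mul_bin_left leq_mul2r.
by apply/orP; right; lia.
Qed.

(** Like a geometric series, the partial sum is at most x/2 times the next binomial; the h further
    steps up to [h * x] gain ((x + 2)/x)^h. *)
Lemma sum_bin_small x h : 0 < x ->
  2 * x.+2 ^ h * (\sum_(i < h * x.-1) 'C(2 * (h * x.+1), i)) <=
  x ^ h.+1 * 'C(2 * (h * x.+1), h * x.+1).
Proof.
move=> x0; set n := 2 * (h * x.+1).
have sumB j : j <= h * x -> 2 * (\sum_(i < j) 'C(n, i)) <= x * 'C(n, j).
  elim: j => [|j IH] jx; first by rewrite big_ord0.
  rewrite big_ord_recr /= mulnDr.
  apply: leq_trans _ (bin_step jx).
  by have := IH (ltnW jx); move: (\sum_(i < j) _) (binomial n j) => B C; nia.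
have powB i j : j + i <= h * x -> x.+2 ^ i * 'C(n, j) <= x ^ i * 'C(n, j + i).
  elim: i j => [|i IH] j jx; first by rewrite addn0.
  rewrite !expnS addnS -addSn.
  apply: leq_trans (_ : x.+2 ^ i * (x * 'C(n, j.+1)) <= _).
    by rewrite -mulnA mulnCA leq_mul2l bin_step ?orbT //; lia.
  by rewrite mulnCA -mulnA leq_mul2l IH ?orbT //; lia.
have qx : h * x.-1 + h = h * x by nia.
rewrite -mulnA mulnCA; apply: leq_trans (_ : x.+2 ^ h * (x * 'C(n, h * x.-1)) <= _).
  by rewrite leq_mul2l sumB ?orbT // -qx leq_addr.
rewrite mulnCA expnS -[leqRHS]mulnA leq_mul2l; apply/orP; right.
apply: leq_trans (powB _ _ _) _; first by rewrite qx.
by rewrite leq_mul2l bin_le_half ?orbT //; nia.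
Qed.

(* Here w - 2h = h (x - 1) = 2 ^ (e + b + 1) is the power of two that
   [frankl_wilson] needs for the forbidden intersection size 2h. *)
Lemma many_parts b e F (h := 2 ^ e) (x := (2 ^ b.+1).+1) (w := h * x.+1)
    (S : 'I_F -> {set {set 'I_(2 * w)}}) : 0 < b ->
  (forall i A, A \in S i -> #|A| = w) ->
  (forall i A B, A \in S i -> B \in S i -> #|A :&: B| != 2 * h) ->
  (forall A : {set 'I_(2 * w)}, #|A| = w -> exists i, A \in S i) ->
  2 * x.+2 ^ h <= F * x ^ h.+1.
Proof.
move=> b0 cS forb cover.
have h0 : 0 < h by rewrite expn_gt0.
have qE : 2 ^ (e + b.+1) = h * x.-1 by rewrite expnD.
have x3 : 3 < x by rewrite /x ltnS -[X in X < _](expn1 2) ltn_exp2l.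
have Sle i : #|S i| <= \sum_(j < h * x.-1) 'C(2 * w, j).
  rewrite -qE; apply: (@frankl_wilson _ _ (2 * h)).
  - by rewrite qE muln_gt0 h0 /= mulnC ltn_pmul2l //; lia.
  - by move=> A /cS->; rewrite qE /w; nia.
  - exact: forb.
have : 'C(2 * w, w) <= F * \sum_(j < h * x.-1) 'C(2 * w, j).
  rewrite -[F]card_ord -sum_nat_const.
  apply: leq_trans (leq_sum _ (fun i _ => Sle i)).
  rewrite -{1}[2 * w]card_ord -card_draws -sum1_card.
  under [leqRHS]eq_bigr do rewrite -sum1_card big_mkcond.
  rewrite exchange_big big_mkcond leq_sum //= => A _.
  rewrite inE; case: eqP => // /cover[i Ai].
  by rewrite (bigD1 i) //= Ai.
have := sum_bin_small h (ltn0Sn _ : 0 < x); rewrite -/w.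
have : 0 < 'C(2 * w, w) by rewrite bin_gt0; lia.
move: 'C(_, w) (\sum_(j < _) _) => C B C0 B1 B2.
rewrite -(leq_pmul2r C0).
apply: leq_trans (_ : 2 * x.+2 ^ h * (F * B) <= _); first by rewrite leq_mul2l B2 orbT.
by rewrite mulnCA -[leqRHS]mulnA leq_mul2l B1 orbT.
Qed.

Local Open Scope ring_scope.

(** * The embedding into the sphere *)

Lemma fold_right_Rplus_sum (f : nat -> R) d :
  List.fold_right Rplus (IZR Z0) (List.map f (List.seq 0 d)) = \sum_(i < d) f i.
Proof.
rewrite -(big_mkord xpredT f) /index_iota subn0.
elim: d 0%N => [|d IH] m /=; first by rewrite big_nil.
by rewrite big_cons IH.
Qed.

(** Any finite type may index the coordinates; the default 0 places the point in R^d for every d >=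
    #|I|. *)
Definition embed (I : finType) (v : I -> R) : point :=
  fun i => if insub i is Some j then v (@enum_val I predT j) else 0.

Lemma embed_ord (I : finType) (v : I -> R) (j : 'I_#|I|) :
  embed v j = v (enum_val j).
Proof. by rewrite /embed valK. Qed.

Lemma embed_out (I : finType) (v : I -> R) i : (#|I| <= i)%N -> embed v i = 0.
Proof. by move=> Ii; rewrite /embed insubF // ltnNge Ii. Qed.

Lemma sum_embed (I : finType) (u v : I -> R) (F : R -> R -> R) d :
  (#|I| <= d)%N -> F 0 0 = 0 ->
  \sum_(i < d) F (embed u i) (embed v i) = \sum_i F (u i) (v i).
Proof.
move=> Id F0; rewrite -(subnKC Id) big_split_ord /= [X in _ + X]big1 ?addr0 => [|i _].
  by rewrite [RHS]big_enum_val; apply: eq_bigr => i _; rewrite !embed_ord.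
by rewrite !embed_out ?leq_addr.
Qed.

Lemma sqnorm_embed (I : finType) (u : I -> R) d :
  (#|I| <= d)%N -> sqnorm d (embed u) = \sum_i u i ^+ 2.
Proof.
move=> Id; rewrite /sqnorm fold_right_Rplus_sum.
under eq_bigr do rewrite RpowE.
by rewrite (sum_embed (F := fun a _ => a ^+ 2) u u) // expr0n.
Qed.

Lemma dist_embed (I : finType) (u v : I -> R) d :
  (#|I| <= d)%N -> Defs.dist d (embed u) (embed v) = Num.sqrt (\sum_i (u i - v i) ^+ 2).
Proof.
move=> Id; rewrite /Defs.dist fold_right_Rplus_sum RsqrtE.
under eq_bigr do rewrite RpowE.
by rewrite (sum_embed (F := fun a b => (a - b) ^+ 2) u v) // subr0 expr0n.
Qed.

Lemma in_Rd_embed (I : finType) (u : I -> R) d :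
  (#|I| <= d)%N -> in_Rd d (embed u).
Proof. by move=> Id i /ssrnat.leP di; rewrite embed_out // (leq_trans Id). Qed.

Lemma sum_sqrB (I : finType) (u v : I -> R) :
  \sum_i (u i - v i) ^+ 2 =
  \sum_i u i * u i + \sum_i v i * v i - 2 * \sum_i u i * v i.
Proof.
rewrite mulr_sumr -!big_split -sumrB; apply: eq_bigr => i _ /=; ring.
Qed.

Definition feature n N (al be ga : R) (x : 'I_n -> R)
    (i : 'I_n + {ffun 'I_N -> 'I_n} + unit) : R :=
  match i with
  | inl (inl i) => al * x i
  | inl (inr f) => be * \prod_j x (f j)
  | inr _ => ga
  end.

(** Tensor powers turn inner products into powers: expanding N equal sums gives one term for each f,
    that is, for each tensor coordinate. *)
Lemma feature_dot n N al be ga (x y : 'I_n -> R) :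
  \sum_i feature (N := N) al be ga x i * feature al be ga y i =
  al ^+ 2 * (\sum_i x i * y i) + be ^+ 2 * (\sum_i x i * y i) ^+ N + ga ^+ 2.
Proof.
rewrite !big_sumType /= (big_pred1 tt) => [|[]] //=.
rewrite -expr2; congr (_ + _ + _).
  by rewrite mulr_sumr; apply: eq_bigr => i _; rewrite mulrACA expr2.
have -> : (\sum_i x i * y i) ^+ N = \prod_(j < N) \sum_i x i * y i.
  by rewrite prodr_const card_ord.
rewrite bigA_distr_bigA mulr_sumr /=.
by apply: eq_bigr => f _; rewrite big_split mulrACA expr2.
Qed.

Definition sgn n (A : {set 'I_n}) (i : 'I_n) : R :=
  (if i \in A then 1 else -1) / Num.sqrt n%:R.

Lemma sgn_dot w (A B : {set 'I_(2 * w)}) : (0 < w)%N -> #|A| = w -> #|B| = w ->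
  \sum_i sgn A i * sgn B i = 2 * #|A :&: B|%:R / w%:R - 1.
Proof.
move=> w0 cA cB.
have nE : Num.sqrt (2 * w)%:R * Num.sqrt (2 * w)%:R = (2 * w)%:R :> R.
  by rewrite -expr2 sqr_sqrtr // ler0n.
have cardE (D : {set 'I_(2 * w)}) : #|D|%:R = \sum_i (i \in D)%:R :> R.
  by rewrite -sum1_card natr_sum big_mkcond; apply: eq_bigr => i _; case: (i \in D).
(* For indicators a and b, (2a - 1)(2b - 1) = 4ab - 2a - 2b + 1. *)
have -> : \sum_i sgn A i * sgn B i = (\sum_i (4 * (i \in A :&: B)%:R
    - 2 * (i \in A)%:R - 2 * (i \in B)%:R + 1)) / (2 * w)%:R.
  rewrite mulr_suml; apply: eq_bigr => i _; rewrite /sgn mulrACA -invfM nE inE.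
  by congr (_ / _); case: (i \in A); case: (i \in B) => /=; ring.
rewrite !big_split /= !sumrN -!mulr_sumr -!cardE sumr_const card_ord cA cB.
have wn0 : w%:R != 0 :> R by rewrite pnatr_eq0 -lt0n.
by rewrite natrM; field.
Qed.

(** Convexity: multiplying the bound for m by t leaves the surplus (m + 1) s^m (t - s)^2. *)
Lemma pow_tangent (t s : R) m : 0 <= t -> 0 <= s ->
  s ^+ m.+1 + m.+1%:R * s ^+ m * (t - s) <= t ^+ m.+1.
Proof.
move=> t0 s0; elim: m => [|m IH]; first by rewrite expr0 !expr1; lra.
have := ler_wpM2l t0 IH; rewrite -exprS => H.
have : 0 <= m.+1%:R * s ^+ m * (t - s) ^+ 2.
  by rewrite mulr_ge0 ?sqr_ge0 // mulr_ge0 ?exprn_ge0.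
rewrite !exprS -[m.+2%:R]natr1 in H *; nra.
Qed.

Lemma even_pow_tangent (t s : R) m : odd m -> 0 <= s ->
  s ^+ m.+1 - m.+1%:R * s ^+ m * (t + s) <= t ^+ m.+1.
Proof.
move=> om s0.
have -> : t ^+ m.+1 = `|t| ^+ m.+1 by rewrite -normrX ger0_norm // exprn_even_ge0 //= om.
apply: le_trans (pow_tangent m (normr_ge0 t) s0).
have : 0 <= m.+1%:R * s ^+ m by rewrite mulr_ge0 ?exprn_ge0.
have : - t <= `|t| by rewrite -normrN ler_norm.
nra.
Qed.

(** The condition a (m + 1) s^m = 1 makes t + a t^(m+1) stationary, hence minimal, at t = -s. The
    squared distance 2q (1 + a - t - a t^(m+1)) is then at most 2qD, and q scales this to 1. The
    inequality on r says that the last coordinate, of square r^2 - q (1 + a), is real. *)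
Lemma spherical_embedding (r a s : R) (m w p d : nat) :
  odd m -> (0 < w)%N -> 0 < a -> 0 < s -> a * m.+1%:R * s ^+ m = 1 ->
  1 + a <= 2 * r ^+ 2 * (1 + a + s - a * s ^+ m.+1) ->
  2 * p%:R / w%:R - 1 = - s ->
  (2 * w + (2 * w) ^ m.+1 + 1 <= d)%N ->
  exists phi : {set 'I_(2 * w)} -> point,
    (forall A : {set _}, #|A| = w -> sphere d r (phi A)) /\
    (forall A B : {set _}, #|A| = w -> #|B| = w -> Defs.dist d (phi A) (phi B) <= 1) /\
    (forall A B : {set _}, #|A| = w -> #|B| = w -> #|A :&: B| = p ->
       Defs.dist d (phi A) (phi B) = 1).
Proof.
move=> om w0 a0 s0 aE rE pE dE.
set D := 1 + a + s - a * s ^+ m.+1 in rE.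
(* Tangency gives a s^(m+1) = s / (m + 1) <= s. *)
have D0 : 0 < D.
  have : a * s ^+ m.+1 * m.+1%:R = s by rewrite exprS; nra.
  have : 0 <= a * s ^+ m.+1 by rewrite mulr_ge0 ?exprn_ge0 // ltW.
  have : 1 <= m.+1%:R :> R by rewrite ler1n.
  by rewrite /D; nra.
pose q := (2 * D)^-1.
have qD : 2 * q * D = 1 by rewrite /q; field; rewrite gt_eqF.
have q0 : 0 < q by rewrite invr_gt0; lra.
have g0 : 0 <= r ^+ 2 - q * (1 + a) by nra.
pose x A := feature (N := m.+1) (Num.sqrt q) (Num.sqrt (a * q))
  (Num.sqrt (r ^+ 2 - q * (1 + a))) (@sgn (2 * w) A).
have dot (A B : {set _}) : #|A| = w -> #|B| = w -> \sum_i x A i * x B i =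
    let t := 2 * #|A :&: B|%:R / w%:R - 1 in
    q * t + a * q * t ^+ m.+1 + (r ^+ 2 - q * (1 + a)).
  move=> cA cB; rewrite feature_dot sgn_dot // !sqr_sqrtr //; last exact: ltW.
  by rewrite mulr_ge0 ?ltW.
have dotxx (A : {set _}) : #|A| = w -> \sum_i x A i * x A i = r ^+ 2.
  move=> cA; rewrite dot // setIid cA mulfK; last by rewrite pnatr_eq0 -lt0n.
  have -> : 2 - 1 = 1 :> R by ring.
  by rewrite /= expr1n; ring.
have cI : (#|{: 'I_(2 * w) + {ffun 'I_m.+1 -> 'I_(2 * w)} + unit}| <= d)%N.
  by rewrite !card_sum card_ffun !card_ord card_unit.
exists (fun A => embed (x A)); split => [A cA|].
  split; first exact: in_Rd_embed.
  rewrite sqnorm_embed // RpowE -(dotxx A cA); apply: eq_bigr => i _.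
  by rewrite expr2.
have dE2 (A B : {set _}) : #|A| = w -> #|B| = w ->
    Defs.dist d (embed (x A)) (embed (x B)) = Num.sqrt (
      let t := 2 * #|A :&: B|%:R / w%:R - 1 in
      2 * q * (1 + a - (t + a * t ^+ m.+1))).
  move=> cA cB; rewrite dist_embed // sum_sqrB !dotxx // dot //=.
  by congr Num.sqrt; ring.
split=> A B cA cB => [|cAB]; rewrite dE2 //=.
  set t := _ - 1.
  rewrite -[leRHS]sqrtr1 ler_wsqrtr // -[leRHS]qD ler_pM2l; last by lra.
  have := even_pow_tangent t om (ltW s0).
  move=> /(ler_wpM2l (ltW a0)).
  have -> : a * (s ^+ m.+1 - m.+1%:R * s ^+ m * (t + s)) =
      a * s ^+ m.+1 - a * m.+1%:R * s ^+ m * (t + s) by ring.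
  by rewrite aE /D; lra.
rewrite cAB pE exprNn -signr_odd oddS om mul1r -[in RHS]sqrtr1; congr Num.sqrt.
by rewrite -[RHS]qD /D; ring.
Qed.

Lemma card_ord_interval n a b : (b <= n)%N ->
  #|[set i : 'I_n | a <= i < b]%N| = (b - a)%N.
Proof.
move=> bn; rewrite -sum1dep_card -(big_mkord (fun i => a <= i < b)%N (fun=> 1%N)).
rewrite -big_nat_widen // -[RHS]muln1 -sum_nat_const_nat.
by rewrite [RHS](big_nat_widenl _ 0%N).
Qed.

(* -s is the cosine of two w-sets meeting in 2h points. *)
Lemma sphere_many_parts (r a s : R) (b e m d : nat)
    (h := (2 ^ e)%N) (x := (2 ^ b.+1).+1) (w := (h * x.+1)%N) (n := (2 * w)%N) :
  (0 < b)%N -> odd m -> 0 < a -> s = (x%:R - 3) / (x%:R + 1) ->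
  a * m.+1%:R * s ^+ m = 1 ->
  1 + a <= 2 * r ^+ 2 * (1 + a + s - a * s ^+ m.+1) ->
  (n + n ^ m.+1 + 1 <= d)%N ->
  exists A : point -> Prop,
    [/\ forall y, A y -> sphere d r y, diam_is d A (IZR 1) &
      forall F, coverable d A (IZR 1) F -> (2 * x.+2 ^ h <= F * x ^ h.+1)%N].
Proof.
move=> b0 om a0 sE aE rE dE.
have h0 : (0 < h)%N by rewrite expn_gt0.
have x3 : (3 < x)%N by rewrite /x ltnS -[X in (X < _)%N](expn1 2) ltn_exp2l.
have w0 : (0 < w)%N by rewrite muln_gt0 h0.
have hR : 0 < h%:R :> R by rewrite ltr0n.
have xR : 3 < x%:R :> R by rewrite (ltr_nat _ 3).
have s0 : 0 < s by rewrite sE divr_gt0 //; lra.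
have pE : 2 * (2 * h)%:R / w%:R - 1 = - s.
  rewrite sE /w !natrM -[x.+1%:R]natr1; field.
  by rewrite !gt_eqF //; lra.
have [phi [phiS [phi_le phi_eq]]] := spherical_embedding om w0 a0 s0 aE rE pE dE.
exists (fun y => exists2 A : {set 'I_n}, #|A| = w & y = phi A); split.
- by move=> _ [A cA ->]; exact: phiS.
- split=> [_ [_ [_ [[A cA ->] [[B cB ->] ->]]]]|t ub]; first exact/RleP/phi_le.
  (* Two intervals of length w overlapping in 2h points attain the distance 1. *)
  pose A := [set i : 'I_n | 0 <= i < w]%N.
  pose B := [set i : 'I_n | w - 2 * h <= i < w + (w - 2 * h)]%N.
  have hw : (2 * h <= w)%N by rewrite /w; nia.
  have cA : #|A| = w by rewrite card_ord_interval ?subn0 // /n; lia.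
  have cB : #|B| = w by rewrite card_ord_interval /n; lia.
  have cAB : #|A :&: B| = (2 * h)%N.
    have -> : A :&: B = [set i : 'I_n | w - 2 * h <= i < w]%N.
      by apply/setP=> i; rewrite !inE; lia.
    by rewrite card_ord_interval /n; lia.
  apply: ub; exists (phi A), (phi B); split; first by exists A.
  by split; [exists B|rewrite phi_eq].
move=> F [P [PA Pd]].
pose S (i : 'I_F) := [set A : {set 'I_n} | (#|A| == w) && `[< P i (phi A) >]].
apply: (@many_parts b e F S b0) => [i A|i A B|A cA].
- by rewrite inE => /andP[/eqP].
- rewrite !inE => /andP[/eqP cA /asboolP PiA] /andP[/eqP cB /asboolP PiB].
  apply/eqP => cAB.
  have [D [/RltP D1 PD]] := Pd i (ssrnat.ltP (ltn_ord i)).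
  have /RleP := PD _ _ PiA PiB; rewrite phi_eq // => D2.
  by move: (lt_le_trans D1 D2); rewrite ltxx.
have /PA[i [/ssrnat.ltP iF Pi]] : exists2 B : {set 'I_n}, #|B| = w & phi A = phi B.
  by exists A.
by exists (Ordinal iF); rewrite inE cA eqxx; apply/asboolP.
Qed.

(** * Choice of the parameters *)

Lemma bernoulli_sub (s : R) m : 0 <= s -> s <= 1 -> 1 - m%:R * (1 - s) <= s ^+ m.
Proof.
move=> s0 s1; elim: m => [|m IH]; first by rewrite mul0r subr0 expr0.
have := exprn_ile1 m s0 s1; rewrite exprS -natr1; nra.
Qed.

(** The condition on k reads 1 + 1/k <= 2 r^2 (2 - 2/k); it holds for large k because 4 r^2 > 1. The
    bracket on the right is at least 2 - 2/k + a. *)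
Lemma radius_ineq (r a s k : R) : 0 < k -> 1 <= (4 * r ^+ 2 - 1) * k - 4 * r ^+ 2 ->
  0 <= a -> a * k <= 1 -> 1 - k^-1 <= s -> s <= 1 ->
  1 + a <= 2 * r ^+ 2 * (1 + a + s - s / (2 * k)).
Proof.
move=> k0 kr a0 ak s0 s1.
have [u uE] : exists u, u = k^-1 by exists k^-1.
have u0 : 0 < u by rewrite uE invr_gt0.
have ku : k * u = 1 by rewrite uE mulfV // gt_eqF.
have au : a <= u by nra.
have -> : s / (2 * k) = s * u / 2 by rewrite uE; field; rewrite gt_eqF.
rewrite -uE in s0.
have [R2 R2E] : exists R2, R2 = 2 * r ^+ 2 by exists (2 * r ^+ 2).
have R20 : 0 <= R2 by rewrite R2E mulr_ge0 ?sqr_ge0.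
have kr2 : u * (1 + 2 * R2) <= 2 * R2 - 1 by rewrite R2E; nra.
rewrite -R2E.
have H1 : 2 - 2 * u + a <= 1 + a + s - s * u / 2 by nra.
apply: le_trans (ler_wpM2l R20 H1).
(* The term a on the left is absorbed by R2 a if R2 >= 1, and otherwise by the slack u >= a. *)
case: (lerP 1 R2) => R21; nra.
Qed.

(** Only powers of two are available as scales; maximality of e bounds d from above in terms of the
    doubled scale. *)
Lemma ex_max_scale y k d : (0 < y -> y + y ^ k + 1 <= d -> exists e,
  y * 2 ^ e + (y * 2 ^ e) ^ k + 1 <= d < y * 2 ^ e.+1 + (y * 2 ^ e.+1) ^ k + 1)%N.
Proof.
move=> y0 yd; pose P e := (y * 2 ^ e + (y * 2 ^ e) ^ k + 1 <= d)%N.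
have P0 : exists e, P e by exists 0%N; rewrite /P expn0 muln1.
have Pd e : P e -> (e <= d)%N.
  by rewrite /P; have := ltn_expl e (isT : (1 < 2)%N); nia.
case: (ex_maxnP P0 Pd) => e Pe emax; exists e; rewrite -/(P e) Pe /= ltnNge.
by apply/negP => /(emax e.+1); rewrite ltnn.
Qed.

Lemma cover_growth (r : R) : Rlt (IZR 1) (Rplus r r) ->
  exists k x y D0 : nat, (0 < k)%coq_nat /\ (0 < x)%coq_nat /\ (0 < y)%coq_nat /\
  forall d, (D0 <= d)%coq_nat -> exists h (A : point -> Prop),
    Rle (INR d) (pow (INR (y * h)) (2 * k)) /\
    (forall z, A z -> sphere d r z) /\ diam_is d A (IZR 1) /\
    (forall F, coverable d A (IZR 1) F ->
    Rle (Rmult (INR 2) (pow (INR x.+2) h)) (Rmult (INR F) (pow (INR x) h.+1))).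
Proof.
have scale u v : (6 * u * v = 3 * (u * (2 * v)))%N by lia.
have sum3 u v : (0 < u -> u <= v -> u + v + 1 <= 3 * v)%N by lia.
move=> /RltP; rewrite RplusE R1E => r1.
have r2 : 0 < 4 * r ^+ 2 - 1 by nra.
have [k [kpos kr]] : exists k : nat,
    (0 < k)%N /\ 1 <= (4 * r ^+ 2 - 1) * k%:R - 4 * r ^+ 2.
  pose k := (Num.truncn ((4 * r ^+ 2 + 1) / (4 * r ^+ 2 - 1))).+1.
  exists k; split=> //.
  have : (4 * r ^+ 2 + 1) / (4 * r ^+ 2 - 1) <= k%:R by exact/ltW/truncnS_gt.
  by rewrite ler_pdivrMr //; lra.
have [m mE] : exists m, m.+1 = (2 * k)%N by exists (2 * k).-1; lia.
(* This size gives x >= 16k, hence 1 - s = 4/(x + 1) <= 1/(4k). By Bernoulli s^m >= 1/2, which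
   yields a <= 1/k. *)
pose b := (16 * k)%N; pose x := (2 ^ b.+1).+1.
have b0 : (0 < b)%N by rewrite muln_gt0.
have kR : 0 < k%:R :> R by rewrite ltr0n.
have xk : 16 * k%:R <= x%:R :> R.
  rewrite -natrM ler_nat /x; apply: leq_trans (leqnSn _).
  by apply: leq_trans (leq_pexp2l _ (leqnSn b)) => //; apply/ltnW/ltn_expl.
pose s : R := ((x%:R - 3) / (x%:R + 1))%R.
have k1 : 1 <= k%:R :> R by rewrite ler1n.
have xR : 0 < x%:R + 1 :> R by lra.
have s1E : 1 - s = 4 / (x%:R + 1).
  by rewrite /s; move: x%:R xR => X xR; field; rewrite gt_eqF.
have s1 : s <= 1 by rewrite -subr_ge0 s1E divr_ge0 // ltW.
have ks : 4 * k%:R * (1 - s) <= 1.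
  by rewrite s1E mulrA ler_pdivrMr //; lra.
have s0 : 0 < s by rewrite /s divr_gt0 //; lra.
have sm : 2^-1 <= s ^+ m.
  apply: le_trans (bernoulli_sub m (ltW s0) s1).
  have : m%:R = 2 * k%:R - 1 :> R by rewrite -natrM -mE -natr1 addrK.
  by move=> ->; nra.
have sm0 : 0 < s ^+ m by rewrite exprn_gt0.
pose a : R := ((2 * k%:R * s ^+ m)^-1)%R.
have a0 : 0 < a by rewrite invr_gt0 !mulr_gt0.
have aE : a * m.+1%:R * s ^+ m = 1.
  by rewrite mE natrM /a; field; rewrite !gt_eqF.
have aS : a * s ^+ m.+1 = s / (2 * k%:R).
  by rewrite exprS /a; field; rewrite !gt_eqF.
have ak : a * k%:R <= 1.
  by rewrite mE natrM in aE; nra.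
have sk : 1 - k%:R^-1 <= s.
  by rewrite lerBlDr -lerBlDl -[leRHS]mul1r ler_pdivlMr //; nra.
have rE := radius_ineq kR kr (ltW a0) ak sk s1.
rewrite -aS in rE.
pose n0 := (2 * x.+1)%N.
(* With z = n0 2^(e+1), d < z + z^(2k) + 1 <= 3 z^(2k) <= (3z)^(2k), and 3z = 6 n0 2^e. The
   threshold on d lets the scale e = 0 fit. *)
exists k, x, (6 * n0)%N, (n0 + n0 ^ (2 * k) + 1)%N.
do 3![split; first exact/ssrnat.ltP].
move=> d /ssrnat.leP dD.
have [e /andP[ed de]] := ex_max_scale (isT : (0 < n0)%N) dD.
have om : odd m by rewrite -[odd m]negbK -oddS mE oddM.
have n0E : (n0 * 2 ^ e = 2 * (2 ^ e * x.+1))%N by rewrite /n0 -mulnA [(x.+1 * _)%N]mulnC.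
rewrite n0E -mE in ed.
have [A [AS Ad AF]] := sphere_many_parts b0 om a0 erefl aE rE ed.
exists (2 ^ e)%N, A; split; last (split=> //; split=> // F /AF).
  apply/RleP; rewrite !INRE RpowE -natrX ler_nat; apply: ltnW.
  apply: leq_trans de _.
  set z := (n0 * 2 ^ e.+1)%N.
  have -> : (6 * n0 * 2 ^ e = 3 * z)%N by rewrite /z expnS scale.
  have z0 : (0 < z)%N by rewrite muln_gt0 expn_gt0.
  have k2 : (1 <= 2 * k)%N by rewrite -mE.
  have zk : (z <= z ^ (2 * k))%N by rewrite -{1}(expn1 z) leq_pexp2l.
  rewrite expnMn; apply: leq_trans (_ : 3 * z ^ (2 * k) <= _)%N; first exact: sum3.
  by rewrite leq_mul2r -{1}(expn1 3) leq_pexp2l // orbT.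
by move=> H; apply/RleP; rewrite !INRE !RpowE !RmultE -!natrX -!natrM ler_nat.
Qed.

(** * Existence of the maximum *)

(** A grid of mesh eps = 1/(2(d + 1)) on the cube of half-side |r| has finitely many cells, each of
    diameter at most eps sqrt(d) <= 1/2. This bounds all Borsuk numbers at once, so their maximum
    exists. *)
Lemma uniform_cover (r : R) d : exists N, forall A : point -> Prop,
  (forall x, A x -> sphere d r x) -> coverable d A (IZR 1) N.
Proof.
pose eps : R := ((2 * d.+1%:R)^-1)%R; pose K := (Num.truncn (2 * `|r| / eps)).+1.
have d0 : 0 < d.+1%:R :> R by rewrite ltr0n.
have eps0 : 0 < eps by rewrite invr_gt0 mulr_gt0.
pose cell (x : point) (i : 'I_d) := (x i + `|r|) / eps.
pose code x : {ffun 'I_d -> 'I_K} := [ffun i => inord (Num.truncn (cell x i))].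
exists #|{: {ffun 'I_d -> 'I_K}}| => A As.
exists (fun i x => A x /\ enum_rank (code x) = i :> nat); split=> [x|i _].
  split=> [Ax|[i [_ []]]] //.
  by exists (enum_rank (code x)); split=> //; apply/ssrnat.ltP.
have cellP x (j : 'I_d) : A x -> `|x j| <= `|r|.
  move=> /As[_]; rewrite /sqnorm fold_right_Rplus_sum RpowE.
  under eq_bigr do rewrite RpowE.
  move=> xr.
  rewrite -ler_sqr ?nnegrE // !real_normK ?num_real // -xr (bigD1 j) //=.
  by rewrite lerDl sumr_ge0 // => k _; rewrite sqr_ge0.
exists (2^-1)%R; split; first by apply/RltP; rewrite R1E invf_lt1 // ltr1n.
move=> x y [Ax <-] [Ay] /val_inj/enum_rank_inj cxy; apply/RleP.
rewrite /Defs.dist fold_right_Rplus_sum RsqrtE.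
have xy (j : 'I_d) : (x j - y j) ^+ 2 <= eps ^+ 2.
  have cK z : A z -> 0 <= cell z j /\ (Num.truncn (cell z j) < K)%N.
    move=> /(cellP z j); rewrite ler_norml => /andP[z1 z2]; split.
      by apply: divr_ge0; [lra|exact: ltW].
    rewrite ltnS; apply: le_truncn; rewrite ler_pM2r ?invr_gt0 //; lra.
  have [x0 xK] := cK _ Ax; have [y0 yK] := cK _ Ay.
  have /(congr1 val) := congr1 (fun f : {ffun 'I_d -> 'I_K} => f j) cxy.
  rewrite !ffunE /= !inordK // => txy.
  have /andP[x1 x2] := truncn_itv x0; have /andP[y1 y2] := truncn_itv y0.
  rewrite -txy -!natr1 in x1 x2 y1 y2.
  have E : x j - y j = eps * (cell x j - cell y j).
    by rewrite /cell; field; rewrite gt_eqF.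
  rewrite E exprMn ler_piMr ?sqr_ge0 //; nra.
have -> : 2^-1 = Num.sqrt (2^-1 ^+ 2) :> R.
  by rewrite sqrtr_sqr ger0_norm ?invr_ge0 ?ler0n.
rewrite ler_wsqrtr //.
under eq_bigr do rewrite RpowE.
apply: le_trans (ler_sum _ (fun j _ => xy j)) _.
rewrite sumr_const card_ord -[leLHS]mulr_natr.
have E : eps * d.+1%:R = 2^-1 by rewrite /eps invfM mulfVK ?gt_eqF.
have d1 : d%:R <= d.+1%:R ^+ 2 :> R by rewrite -natrX ler_nat; nia.
by rewrite -E exprMn ler_wpM2l ?sqr_ge0.
Qed.

Lemma f_r_ge (r : R) d (A : point -> Prop) :
  (forall x, A x -> sphere d r x) -> diam_is d A (IZR 1) ->
  exists n m, f_r_is r d n /\ (m <= n)%coq_nat /\ coverable d A (IZR 1) m.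
Proof.
move=> AS Ad; have [N NP] := uniform_cover r d.
have borsuk B : (forall x, B x -> sphere d r x) -> diam_is d B (IZR 1) ->
    exists n, borsuk_number d B n.
  move=> BS Bd.
  have ex : exists n, `[< coverable d B (IZR 1) n >] by exists N; apply/asboolP/NP.
  case: (ex_minnP ex) => n /asboolP nP nmin; exists n, (IZR 1); split=> //; split=> //.
  by move=> m /asboolP/nmin/ssrnat.leP.
have borsukN B n : (forall x, B x -> sphere d r x) -> diam_is d B (IZR 1) ->
    borsuk_number d B n -> coverable d B (IZR 1) n /\ (n <= N)%N.
  move=> BS Bd [D [BD [cD minD]]].
  have D1 : D = IZR 1.
    by apply: Rle_antisym; [apply: BD.2 Bd.1|apply: Bd.2 BD.1].
  by rewrite D1 in cD minD; split=> //; apply/ssrnat.leP/minD/NP.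
pose P n := `[< exists2 B : point -> Prop, (forall x, B x -> sphere d r x) &
   diam_is d B (IZR 1) /\ borsuk_number d B n >].
have [m mA] := borsuk A AS Ad.
have exP : exists n, P n by exists m; apply/asboolP; exists A.
have PN n : P n -> (n <= N)%N.
  by move=> /asboolP[B BS [Bd nB]]; have [] := borsukN _ _ BS Bd nB.
case: (ex_maxnP exP PN) => n /asboolP[B BS [Bd nB]] nmax.
exists n, m; split; last split.
- split; first by exists B.
  move=> C l CS Cd lC; apply/ssrnat.leP/nmax/asboolP.
  by exists C.
- by apply/ssrnat.leP/nmax/asboolP; exists A.
- by have [] := borsukN _ _ AS Ad mA.
Qed.

(** The points (1/2, g) and (-1/2, g) with g^2 = r^2 - 1/4. They serve the small dimensions, where
    only a nonempty set of diameter 1 is required. *)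
Lemma two_point_set (r : R) d : Rlt (IZR 1) (Rplus r r) -> (2 <= d)%coq_nat ->
  exists A : point -> Prop, (forall x, A x -> sphere d r x) /\ diam_is d A (IZR 1).
Proof.
move=> /RltP; rewrite RplusE R1E => r1 /ssrnat.leP d2.
pose v (c : bool) (i : bool) : R :=
  (if i then (if c then 2^-1 else - 2^-1) else Num.sqrt (r ^+ 2 - 4^-1))%R.
have cb : (#|{: bool}| <= d)%N by rewrite card_bool.
have r2 : 0 <= r ^+ 2 - 4^-1 by nra.
exists (fun x => exists c, x = embed (v c)); split=> [_ [c ->]|].
  split; first exact: in_Rd_embed.
  rewrite sqnorm_embed // RpowE big_bool /= sqr_sqrtr //.
  by case: c; field.
have dv c c' : Defs.dist d (embed (v c)) (embed (v c')) = (c != c')%:R.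
  rewrite dist_embed // big_bool /= subrr expr0n addr0.
  case: c c' => [] [] /=; rewrite ?subrr ?expr0n ?sqrtr0 //.
    by rewrite (_ : 2^-1 - _ = 1) ?expr1n ?sqrtr1 //; field.
  by rewrite (_ : - 2^-1 - _ = -1) ?sqrrN ?expr1n ?sqrtr1 //; field.
split=> [_ [_ [_ [[c ->] [[c' ->] ->]]]]|b ub].
  by apply/RleP; rewrite dv lern1 leq_b1.
apply: ub; exists (embed (v true)), (embed (v false)); split; first by exists true.
by split; [exists false|rewrite dv].
Qed.

End SphericalBorsuk.

(** * The growth rate *)

(** With s = (x + 2)/x the hypothesis is 2 s^h <= F x. Half of the exponent pays for x: Bernoulli
    and h >= x^3 give s^h >= x^2, so x <= s^(h/2). *)
Lemma power_le_parts (x h F : nat) :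
  (0 < x)%nat -> (x * x * x <= h)%nat ->
  INR 2 * INR (S (S x)) ^ h <= INR F * INR x ^ (S h) ->
  Rpower (INR (S (S x)) / INR x) (INR h / 2) <= INR F.
Proof.
intros x0 xh HF.
assert (X1 : 1 <= INR x) by (apply (le_INR 1); lia).
assert (XH : INR x * INR x * INR x <= INR h)
  by (rewrite <- !mult_INR; apply le_INR; lia).
rewrite !S_INR in *.
set (X := INR x) in *; set (H := INR h) in *.
set (s := (X + 1 + 1) / X) in *.
assert (sE : s = 1 + 2 / X) by (unfold s; field; lra).
assert (X2 : 0 < 2 / X) by (apply Rdiv_lt_0_compat; lra).
assert (s0 : 0 < s) by lra.
assert (HF' : 2 * s ^ h <= INR F * X).
{ replace (X + 1 + 1) with (s * X) in HF by (unfold s; field; lra).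
  rewrite Rpow_mult_distr in HF; simpl in HF.
  assert (P : 0 < X ^ h) by (apply pow_lt; lra).
  apply (Rmult_le_reg_r (X ^ h)); [exact P | simpl in *; nra]. }
assert (B : X * X <= s ^ h).
{ pose proof (poly h (2 / X) X2) as B; rewrite <- sE in B; fold H in B.
  assert (X * X * X * (2 / X) <= H * (2 / X)) by (apply Rmult_le_compat_r; lra).
  replace (X * X * X * (2 / X)) with (2 * (X * X)) in * by (field; lra).
  nra. }
assert (sq : s ^ h = Rpower s (H / 2) * Rpower s (H / 2)).
{ rewrite <- Rpower_plus, <- (Rpower_pow h s s0); f_equal; fold H; field. }
assert (0 < Rpower s (H / 2)) by apply exp_pos.
set (t := Rpower s (H / 2)) in *; rewrite sq in *.
assert (X <= t) by nra.
nra.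
Qed.

Lemma Rpower_le_scale (s q t : R) (h d : nat) :
  1 < s -> 0 < q -> 0 < t -> (0 < d)%nat -> INR d <= Rpower (q * INR h) t ->
  (0 < h)%nat ->
  Rpower (Rpower s (/ (2 * q))) (Rpower (INR d) (/ t)) <= Rpower s (INR h / 2).
Proof.
intros s1 q0 t0 d0 dh h0.
assert (D : 0 < INR d) by (apply lt_0_INR; lia).
assert (H : 0 < INR h) by (apply lt_0_INR; lia).
assert (E : Rpower (INR d) (/ t) <= q * INR h).
{ rewrite <- (Rpower_1 (q * INR h)) by nra.
  replace 1 with (t * / t) by (field; lra).
  rewrite <- Rpower_mult; apply Rle_Rpower_l; [|lra].
  left; apply Rinv_0_lt_compat; lra. }
rewrite Rpower_mult; apply Rle_Rpower; [lra|].
apply (Rmult_le_reg_l (2 * q)); [lra|].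
rewrite <- Rmult_assoc, Rinv_r, Rmult_1_l by lra.
lra.
Qed.

Theorem theorem2 :
  forall r : R, 1/2 < r ->
  exists (k : nat) (c : R) (delta : nat -> R),
    (0 < k)%nat /\ 1 < c /\ Un_cv delta 0 /\
    forall d : nat, (2 <= d)%nat ->
      exists n : nat, f_r_is r d n /\
        Rpower (c + delta d) (Rpower (INR d) (/ (2 * INR k))) <= INR n.
Proof.
intros r hr.
assert (r1 : 1 < r + r) by lra.
destruct (SphericalBorsuk.cover_growth r1)
  as (k & x & y & D0 & k0 & x0 & y0 & large).
assert (X0 : 0 < INR x) by (apply lt_0_INR; lia).
assert (Y0 : 0 < INR y) by (apply lt_0_INR; lia).
assert (K0 : 0 < INR k) by (apply lt_0_INR; lia).
set (s := INR (S (S x)) / INR x).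
assert (s1 : 1 < s).
{ apply (Rmult_lt_reg_r (INR x)); [exact X0|].
  unfold s, Rdiv; rewrite Rmult_assoc, Rinv_l, !S_INR by lra; lra. }
set (c := Rpower s (/ (2 * INR y))).
assert (c1 : 1 < c).
{ rewrite <- (Rpower_O s) by lra; apply Rpower_lt; [exact s1|].
  apply Rinv_0_lt_compat; lra. }
(* The second summand forces h >= x^3, since a smaller h would give d <= (y x^3)^(2k). *)
set (D1 := (D0 + (y * (x * x * x)) ^ (2 * k) + 1)%nat).
(* Below D1 the base becomes 1, so the bound only asks for one part; from D1 on delta vanishes. *)
exists k, c, (fun d => if Nat.ltb d D1 then 1 - c else 0).
split; [exact k0|]; split; [exact c1|]; split.
{ intros eps e0; exists D1; intros n nD.
  destruct (Nat.ltb_spec n D1); [lia|].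
  unfold Rdist; rewrite Rminus_diag, Rabs_R0; exact e0. }
intros d d2; destruct (Nat.ltb_spec d D1) as [small|big].
- destruct (SphericalBorsuk.two_point_set r1 d2) as (A & AS & Ad).
  destruct (SphericalBorsuk.f_r_ge AS Ad) as (n & m & fn & mn & cm).
  exists n; split; [exact fn|].
  replace (c + (1 - c)) with 1 by ring.
  unfold Rpower at 1; rewrite ln_1, Rmult_0_r, exp_0; apply (le_INR 1).
  (* Zero parts cover only the empty set, whose distances have 0 as an upper bound, against the
     supremum 1. *)
  destruct m as [|m]; [exfalso|lia].
  destruct cm as (P & PA & _).
  assert (none : forall z, ~ A z)
    by (intros z Az; apply PA in Az; destruct Az as (i & i0 & _); lia).
  destruct Ad as [_ least].
  assert (1 <= 0); [|lra].
  apply least; intros t (u & v & Au & _); destruct (none u Au).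
- destruct (large d) as (h & A & dh & AS & Ad & AF); [lia|].
  change (INR d <= INR (y * h) ^ (2 * k)) in dh.
  destruct (SphericalBorsuk.f_r_ge AS Ad) as (n & m & fn & mn & cm).
  exists n; split; [exact fn|]; rewrite Rplus_0_r.
  assert (xh : (x * x * x <= h)%nat).
  { destruct (Nat.le_gt_cases (x * x * x) h) as [|hx]; [assumption|exfalso].
    rewrite <- pow_INR in dh; apply INR_le in dh.
    assert ((y * h) ^ (2 * k) <= (y * (x * x * x)) ^ (2 * k))%nat
      by (apply Nat.pow_le_mono_l, Nat.mul_le_mono_l; lia).
    unfold D1 in big; lia. }
  assert (h0 : (0 < h)%nat) by nia.
  apply Rle_trans with (INR m); [|apply le_INR; exact mn].
  apply Rle_trans with (2 := power_le_parts x h m x0 xh (AF m cm)).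
  apply Rpower_le_scale; [exact s1|exact Y0|lra|lia| |exact h0].
  rewrite <- mult_INR.
  replace (2 * INR k) with (INR (2 * k)) by (rewrite mult_INR; reflexivity).
  rewrite Rpower_pow; [exact dh|apply lt_0_INR; nia].
Qed.
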